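(* Let $k\ge2$ and $m\ge1$ be integers. Let $\lambda,\mu$ be permutations of $\{1,\dots,m\}$, both without self-overlaps, such that each of the sets $P_{\lambda,k}=\{\lambda,\,12\cdots k\}$ and $P_{\mu,k}=\{\mu,\,12\cdots k\}$ is an antichain (neither pattern in the set occurs as a consecutive pattern in the other). Assume $\lambda(1)=\mu(1)$, $\lambda(m)=\mu(m)$, $l_I(\lambda)=l_I(\mu)$ and $l_T(\lambda)=l_T(\mu)$. Then for every $n\ge0$, the number of permutations of $\{1,\dots,n\}$ avoiding both patterns of $P_{\lambda,k}$ equals the number of permutations of $\{1,\dots,n\}$ avoiding both patterns of $P_{\mu,k}$. (That is, this number depends only on $n$, $m$, $\lambda(1)$, $\lambda(m)$, $l_I(\lambda)$, $l_T(\lambda)$ and $k$.)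
   Context: $12\cdots k$ denotes the identity (increasing) permutation of $\{1,\dots,k\}$. For a permutation $\lambda$ of $\{1,\dots,m\}$, $l_I(\lambda)$ is the largest $j$ with $\lambda(1)<\lambda(2)<\dots<\lambda(j)$ (length of the maximal initial increasing run), and $l_T(\lambda)$ is the largest $j$ with $\lambda(m-j+1)<\dots<\lambda(m)$ (length of the maximal terminal increasing run). For a word $s=s_1\dots s_r$ of distinct integers, $\mathrm{st}(s)$ is the permutation $\rho$ of $\{1,\dots,r\}$ with $s_i<s_l\iff\rho_i<\rho_l$. A permutation $\sigma$ contains the pattern $\pi$ of length $r$ if $\mathrm{st}(\sigma_i\dots\sigma_{i+r-1})=\pi$ for some $i$ (an occurrence), and avoids it otherwise. A pattern of length $m$ has no self-overlaps if every permutation of length at most $2m-2$ has at most one occurrence of it. *)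

(* Defs.v *)
From mathcomp Require Import all_boot all_fingroup.
Set Implicit Arguments.
Unset Strict Implicit.
Unset Printing Implicit Defensive.

(* One-line notation s(1) ... s(n), with entries shifted to {1, ..., n}. *)
Definition oneline n (s : 'S_n) : seq nat := [seq (s i).+1 | i <- enum 'I_n].

(* [standardizes w rho] says st(w) = rho, for a word w of distinct integers. *)
Definition standardizes r (w : seq nat) (rho : 'S_r) : bool :=
  (size w == r) &&
  [forall i : 'I_r, forall l : 'I_r,
     (nth 0 w i < nth 0 w l) == (rho i < rho l)].

(* Starting positions (0-based) of the consecutive occurrences of p in s; when
   fewer than r letters remain the factor is too short to standardize to p.
   Ranging over 'I_n loses nothing as long as r > 0. *)
Definition occurrences n r (s : 'S_n) (p : 'S_r) : {set 'I_n} :=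
  [set i : 'I_n | standardizes (take r (drop i (oneline s))) p].

Definition contains n r (s : 'S_n) (p : 'S_r) : bool :=
  occurrences s p != set0.

Definition no_self_overlaps m (p : 'S_m) : Prop :=
  forall n (s : 'S_n), n <= 2 * m - 2 -> #|occurrences s p| <= 1.

Definition lI m (p : 'S_m) : nat :=
  \max_(j < m.+1 | sorted ltn (take j (oneline p))) j.

Definition lT m (p : 'S_m) : nat :=
  \max_(j < m.+1 | sorted ltn (drop (m - j) (oneline p))) j.

(* A pattern bundled with its length; finite sets of patterns are sequences. *)
Definition pattern : eqType := {r : nat & 'S_r}.

Definition to_pattern r (p : 'S_r) : pattern := Tagged (fun r => 'S_r) p.

Definition antichain (P : seq pattern) : Prop :=
  forall p q : pattern, p \in P -> q \in P -> p != q ->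
    ~~ contains (tagged p) (tagged q).

Definition avoids n (s : 'S_n) (P : seq pattern) : bool :=
  all (fun p : pattern => ~~ contains s (tagged p)) P.

(* P_{lambda,k} = {lambda, 12...k}; the identity of 'S_k is 12...k. *)
Definition Pset m (lam : 'S_m) (k : nat) : seq pattern :=
  [:: to_pattern lam; to_pattern (1%g : 'S_k)].

(* Main.v *)
Require Import Defs.
From mathcomp Require Import all_boot all_fingroup.
From mathcomp Require Import zify.

(**
  Occurrences of a pattern without self-overlaps share at most an endpoint.
  Hence, for a set A of starting positions, the occurrences of lambda starting
  in A can be turned simultaneously into occurrences of mu by composing with
  one permutation of positions that depends only on A: on each window it acts
  as lambda^-1 o mu, which fixes both endpoints.  An occurrence of 12...k meets
  a window in a proper prefix or suffix of it (antichain condition), so that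
  l_I and l_T guarantee that it stays increasing; letters outside the interiors
  of the windows do not move.  Thus, among the permutations avoiding 12...k, as
  many have lambda at all positions of A as have mu there; inclusion-exclusion
  over A gives the theorem.
*)

Set Implicit Arguments.
Unset Strict Implicit.
Unset Printing Implicit Defensive.

Local Open Scope nat_scope.

(** * One-line notation, occurrences and standardization *)

Lemma size_oneline n (s : 'S_n) : size (oneline s) = n.
Proof. by rewrite size_map size_enum_ord. Qed.

Lemma nth_oneline n (s : 'S_n) (x : 'I_n) : nth 0 (oneline s) x = (s x).+1.
Proof. by rewrite (nth_map x) ?size_enum_ord // nth_ord_enum. Qed.

Lemma nth_oneline_addn n r (s : 'S_n) (i : 'I_n) (x : 'I_r) (Hx : i + x < n) :
  nth 0 (oneline s) (i + x) = (s (Ordinal Hx)).+1.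
Proof. exact: nth_oneline (Ordinal Hx). Qed.

Lemma occurrencesP n r (s : 'S_n) (p : 'S_r) (i : 'I_n) :
  reflect (i + r <= n /\ forall a b : 'I_r,
             (nth 0 (oneline s) (i + a) < nth 0 (oneline s) (i + b))
             = (p a < p b))
          (i \in occurrences s p).
Proof.
rewrite inE /standardizes size_take size_drop size_oneline.
have -> : ((if r < n - i then r else n - i) == r) = (i + r <= n).
  by have := ltn_ord i; case: (ltnP r (n - i)); lia.
apply: (iffP andP) => -[Hir Hp]; split=> //.
  move=> a b; move/forallP/(_ a)/forallP/(_ b)/eqP: Hp.
  by rewrite !nth_take // !nth_drop.
apply/forallP=> a; apply/forallP=> b.
by rewrite !nth_take // !nth_drop Hp.
Qed.

(** Adjacent comparisons suffice by transitivity. This local form suits the replacement argument,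
    which treats one pair of neighbours at a time. *)
Lemma occurrences_idP n k (s : 'S_n) (t : 'I_n) :
  reflect (t + k <= n /\ forall a, a.+1 < k ->
             nth 0 (oneline s) (t + a) < nth 0 (oneline s) (t + a.+1))
          (t \in occurrences s (1%g : 'S_k)).
Proof.
apply: (iffP (occurrencesP _ _ _)) => -[Htk Hinc]; split=> //.
  move=> a Ha; have Ha' := ltnW Ha.
  by have := Hinc (Ordinal Ha') (Ordinal Ha); rewrite !perm1 /= => ->.
have mono a b : a < b -> b < k ->
    nth 0 (oneline s) (t + a) < nth 0 (oneline s) (t + b).
  elim: b => // b IHb; rewrite ltnS leq_eqVlt => /predU1P[->|lt_ab] Hb.
    exact: Hinc.
  by apply: ltn_trans (Hinc _ Hb); apply: IHb => //; apply: ltnW.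
move=> a b; rewrite !perm1.
case: (ltngtP a b) => [lt_ab|lt_ba|->]; last by rewrite ltnn.
  exact: mono.
by apply/negbTE; rewrite -leqNgt ltnW // mono.
Qed.

(** The witness is the rank: [t x] counts the indices whose [f]-value lies below [f x]. *)
Lemma standardization r (f : 'I_r -> nat) :
  injective f -> exists t : 'S_r, forall x y, (t x < t y) = (f x < f y).
Proof.
move=> f_inj.
have rank_lt x : #|[set y | f y < f x]| < r.
  rewrite -[X in _ < X]card_ord -cardsT; apply: proper_card.
  by apply/properP; split; [exact: subsetT | exists x; rewrite ?inE ?ltnn].
pose g x := Ordinal (rank_lt x).
have g_mono x y : f x < f y -> g x < g y.
  move=> lt_xy; apply: proper_card; apply/properP; split.
    by apply/subsetP=> z; rewrite !inE => /ltn_trans; apply.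
  by exists x; rewrite !inE ?ltnn.
have g_lt x y : (g x < g y) = (f x < f y).
  case: (ltngtP (f x) (f y)) => [/g_mono|/g_mono|/f_inj->] //; last by rewrite ltnn.
  by move=> lt_yx; apply/negbTE; rewrite -leqNgt ltnW.
have g_inj : injective g.
  move=> x y eq_g; apply: f_inj.
  by case: (ltngtP (f x) (f y)) => // /g_mono; rewrite eq_g ltnn.
by exists (perm g_inj) => x y; rewrite !permE.
Qed.

(** If the two windows shared at least two letters, the factor of [s] that they cover, of length
    [j - i + m <= 2 * m - 2], would standardize to a permutation with occurrences of [p] at [0] and
    at [j - i]. *)
Lemma no_self_overlaps_separated m n (p : 'S_m) (s : 'S_n) (i j : 'I_n) :
  no_self_overlaps p -> i \in occurrences s p -> j \in occurrences s p ->
  i < j -> i + m <= j.+1.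
Proof.
move=> nso /occurrencesP[Hi Oi] /occurrencesP[Hj Oj] lt_ij.
case: leqP => // lt_j.
pose r := j - i + m.
have in_n (x : 'I_r) : i + x < n by have := ltn_ord x; rewrite /r; lia.
have f_inj : injective (fun x : 'I_r => nth 0 (oneline s) (i + x)).
  move=> x y; rewrite !(nth_oneline_addn _ (in_n _)) => -[] /val_inj/perm_inj.
  by case=> /addnI/val_inj.
have [t tP] := standardization f_inj.
have t_lt (x y : 'I_r) : (nth 0 (oneline t) x < nth 0 (oneline t) y)
    = (nth 0 (oneline s) (i + x) < nth 0 (oneline s) (i + y)).
  by rewrite !nth_oneline ltnS tP.
have lt0 : 0 < r by rewrite /r; lia.
have lt1 : j - i < r by rewrite /r; lia.
have r_small : r <= 2 * m - 2 by rewrite /r; lia.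
have := nso r t r_small; rewrite leqNgt => /negP[]; apply/card_gt1P.
exists (Ordinal lt0), (Ordinal lt1); split.
- apply/occurrencesP; split=> [|a b] /=; first by rewrite /r; lia.
  have La : a < r by have := ltn_ord a; rewrite /r; lia.
  have Lb : b < r by have := ltn_ord b; rewrite /r; lia.
  by rewrite !add0n (t_lt (Ordinal La) (Ordinal Lb)) Oi.
- apply/occurrencesP; split=> [|a b] //=.
  have La : j - i + a < r by have := ltn_ord a; rewrite /r; lia.
  have Lb : j - i + b < r by have := ltn_ord b; rewrite /r; lia.
  rewrite (t_lt (Ordinal La) (Ordinal Lb)) /= !addnA subnKC ?Oj //; exact: ltnW.
- by rewrite -val_eqE /=; lia.
Qed.

(** * Initial and terminal increasing runs *)

Lemma leq_lI m (p : 'S_m) j : j <= m ->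
  (forall a, a.+1 < j -> nth 0 (oneline p) a < nth 0 (oneline p) a.+1) ->
  j <= lI p.
Proof.
move=> le_jm Hinc; have Hj : j < m.+1 by [].
apply: (@leq_bigmax_cond _ _ (fun j : 'I_m.+1 => j : nat) (Ordinal Hj)).
apply/(sortedP 0) => a; rewrite size_take_min /= => Ha.
have {}Ha : a.+1 < j by apply: leq_trans Ha _; rewrite geq_minl.
by rewrite !nth_take //; [exact: Hinc | exact: ltnW].
Qed.

Lemma lI_increasing m (p : 'S_m) a : a.+1 < lI p ->
  nth 0 (oneline p) a < nth 0 (oneline p) a.+1.
Proof.
(* The empty prefix is sorted, so the maximum ranges over a nonempty set and is attained. *)
have P0 : 0 < #|[pred j : 'I_m.+1 | sorted ltn (take j (oneline p))]|.
  by apply/card_gt0P; exists ord0; rewrite inE /= take0.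
have [j Hj lI_j] := eq_bigmax_cond (fun j : 'I_m.+1 => j : nat) P0.
rewrite /lI; rewrite lI_j => lt_aj; move/(sortedP 0): Hj => /(_ a).
rewrite size_take size_oneline !nth_take //; last exact: ltnW.
by apply; have := ltn_ord j; case: ifP; lia.
Qed.

Lemma leq_lT m (p : 'S_m) j : j <= m ->
  (forall a, m - j <= a -> a.+1 < m ->
     nth 0 (oneline p) a < nth 0 (oneline p) a.+1) ->
  j <= lT p.
Proof.
move=> le_jm Hinc; have Hj : j < m.+1 by [].
apply: (@leq_bigmax_cond _ _ (fun j : 'I_m.+1 => j : nat) (Ordinal Hj)).
apply/(sortedP 0) => a; rewrite size_drop size_oneline /= => Ha.
by rewrite !nth_drop addnS Hinc //; lia.
Qed.

Lemma lT_increasing m (p : 'S_m) a : m - lT p <= a -> a.+1 < m ->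
  nth 0 (oneline p) a < nth 0 (oneline p) a.+1.
Proof.
have P0 : 0 < #|[pred j : 'I_m.+1 | sorted ltn (drop (m - j) (oneline p))]|.
  by apply/card_gt0P; exists ord0; rewrite inE /= subn0 drop_oversize ?size_oneline.
have [j Hj lT_j] := eq_bigmax_cond (fun j : 'I_m.+1 => j : nat) P0.
rewrite /lT; rewrite lT_j => le_a lt_a.
move/(sortedP 0): Hj => /(_ (a - (m - j))).
rewrite size_drop size_oneline !nth_drop addnS subnKC //; apply.
by have := ltn_ord j; lia.
Qed.

(** * Permuting positions inside windows *)

Section WindowPermutations.

Variables (m n : nat).
Implicit Types (rho : 'S_m) (A : {set 'I_n}) (q : 'S_n).

Definition acts_on_windows rho A q : Prop :=
  (forall (a : 'I_n) (i : 'I_m) (x : 'I_n),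
     a \in A -> x = a + i :> nat -> q x = a + rho i :> nat) /\
  (forall x : 'I_n,
     (forall (a : 'I_n) (i : 'I_m), a \in A -> x <> a + i :> nat) -> q x = x).

Definition separated_windows A : Prop :=
  (forall a : 'I_n, a \in A -> a + m <= n) /\
  (forall a b : 'I_n, a \in A -> b \in A -> a < b -> a + m <= b.+1).

(** The last position of one window may be the first of another. The two translates of [rho]
    prescribe the same image there only if [rho] fixes both ends. *)
Definition fixes_endpoints rho : Prop :=
  forall i : 'I_m, (i == 0 :> nat) || (i.+1 == m) -> rho i = i.

Lemma fixes_endpointsV rho : fixes_endpoints rho -> fixes_endpoints rho^-1.
Proof. by move=> fix_rho i /fix_rho rho_i; apply: (@perm_inj _ rho); rewrite permKV rho_i. Qed.

Lemma acts_on_windowsV rho A q : separated_windows A ->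
  acts_on_windows rho A q -> acts_on_windows rho^-1 A q^-1.
Proof.
move=> [inA _] [q_in q_out]; split=> [a i x Aa xE | x /q_out qx].
  have Hy : a + rho^-1%g i < n.
    by have := inA _ Aa; have := ltn_ord (rho^-1%g i); lia.
  have qy : q (Ordinal Hy) = x.
    by apply: val_inj; rewrite /= (q_in a (rho^-1%g i)) // permKV.
  by rewrite -qy permK.
by rewrite -{1}qx permK.
Qed.

(** When two windows contain [x], [pick] selects either one. The default of [insubd] is not reached
    as long as the windows fit into ['I_n]. *)
Definition window_shift rho A (x : 'I_n) : 'I_n :=
  if [pick c : 'I_n * 'I_m | (c.1 \in A) && (x == c.1 + c.2 :> nat)] is Some c
  then insubd x (c.1 + rho c.2) else x.

(** The choice made by [pick] does not matter: a position shared by two separated windows is an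
    endpoint of both, hence fixed by [rho] in either. *)
Lemma window_shift_in rho A (a : 'I_n) (i : 'I_m) (x : 'I_n) :
  separated_windows A -> fixes_endpoints rho ->
  a \in A -> x = a + i :> nat -> window_shift rho A x = a + rho i :> nat.
Proof.
move=> [inA sepA] fix_rho Aa xE; rewrite /window_shift.
case: pickP => [[b j] /= /andP[Ab /eqP xE']|/(_ (a, i)) /=]; last first.
  by rewrite Aa xE eqxx.
rewrite val_insubd; have -> : b + rho j < n.
  by have := inA _ Ab; have := ltn_ord (rho j); lia.
have {}xE' : x = b + j :> nat := xE'; have := ltn_ord i; have := ltn_ord j.
case: (ltngtP a b) => [lt_ab|lt_ba|/val_inj eq_ab] lt_j lt_i.
- by have dist_ab := sepA _ _ Aa Ab lt_ab; rewrite !fix_rho; lia.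
- by have dist_ab := sepA _ _ Ab Aa lt_ba; rewrite !fix_rho; lia.
by move: xE'; rewrite xE eq_ab => /addnI/val_inj->.
Qed.

Lemma window_shift_out rho A (x : 'I_n) :
  (forall (a : 'I_n) (i : 'I_m), a \in A -> x <> a + i :> nat) ->
  window_shift rho A x = x.
Proof.
move=> out_x; rewrite /window_shift.
by case: pickP => // -[a i] /= /andP[/out_x Hx /eqP/Hx].
Qed.

Lemma window_shiftK rho A : separated_windows A -> fixes_endpoints rho ->
  cancel (window_shift rho A) (window_shift rho^-1 A).
Proof.
move=> sepA fix_rho x.
case: (pickP [pred c : 'I_n * 'I_m | (c.1 \in A) && (x == c.1 + c.2 :> nat)]).
  case=> a i /= /andP[Aa /eqP xE]; apply: val_inj.
  rewrite /= (@window_shift_in _ A a (rho i)) ?permK //.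
    exact: fixes_endpointsV.
  exact: window_shift_in.
move=> no_window.
have out_x (a : 'I_n) (i : 'I_m) : a \in A -> x <> a + i :> nat.
  by move=> Aa xE; have := no_window (a, i); rewrite /= Aa xE eqxx.
by rewrite (window_shift_out rho) ?window_shift_out.
Qed.

Lemma window_permutation rho A : separated_windows A -> fixes_endpoints rho ->
  exists q, acts_on_windows rho A q.
Proof.
move=> sepA fix_rho; exists (perm (can_inj (window_shiftK sepA fix_rho))).
split=> [a i x Aa xE | x out_x]; rewrite permE.
  exact: window_shift_in.
exact: window_shift_out.
Qed.

End WindowPermutations.

(** * Replacing lambda by mu in the chosen windows *)

Section Replacement.

Variables (m n : nat) (lam mu : 'S_m).

(** Products apply the left factor first, so [lam (rho i) = mu i]: reading a copy of [lam] in the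
    order given by [rho] yields [mu]. *)
Let rho : 'S_m := (mu * lam^-1)%g.

Variables (A : {set 'I_n}) (q s : 'S_n).
Hypotheses (q_windows : acts_on_windows rho A q)
  (A_lam : A \subset occurrences s lam).

Let inA a : a \in A -> a + m <= n.
Proof. by move/(subsetP A_lam)/occurrencesP=> []. Qed.

Lemma occurrences_replaced : A \subset occurrences (q * s)%g mu.
Proof.
have [q_in _] := q_windows.
apply/subsetP=> a Aa; have le_amn := inA Aa; apply/occurrencesP; split=> // i j.
have in_n (l : 'I_m) : a + l < n by have := ltn_ord l; lia.
rewrite !(nth_oneline_addn _ (in_n _)) !permM ltnS.
have qE (l : 'I_m) : q (Ordinal (in_n l)) = Ordinal (in_n (rho l)).
  by apply: val_inj; exact: q_in.
rewrite !qE; have [_ /(_ (rho i) (rho j))] := occurrencesP _ _ _ (subsetP A_lam _ Aa).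
by rewrite !(nth_oneline_addn _ (in_n _)) ltnS => ->; rewrite !permM !permKV.
Qed.

Variable k : nat.
Hypotheses (lam_avoids_id : ~~ contains lam (1%g : 'S_k))
  (id_avoids_lam : ~~ contains (1%g : 'S_k) lam).
Hypotheses (hI : lI lam = lI mu) (hT : lT lam = lT mu).
Hypothesis fix_rho : fixes_endpoints rho.

Lemma occurrences_id_replaced :
  occurrences s (1%g : 'S_k) \subset occurrences (q * s)%g (1%g : 'S_k).
Proof.
have [q_in q_out] := q_windows.
apply/subsetP=> t /occurrences_idP[le_tkn inc_t].
apply/occurrences_idP; split=> // b lt_b.
(* Either one window contains both neighbours [t + b] and [t + b.+1], and [mu] decides their order,
   or no window does, and neither position moves. *)
case: (pickP [pred a in A | (a <= t + b) && (t + b.+1 < a + m)]) => [a|no_window].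
  case/and3P=> Aa le_a lt_a.
  have le_amn := inA Aa.
  have [_ occ_a] := occurrencesP _ _ _ (subsetP A_lam _ Aa).
  have [_ occ_mu] := occurrencesP _ _ _ (subsetP occurrences_replaced _ Aa).
  have lam_inc i : t <= a + i -> a + i.+1 < t + k -> i.+1 < m ->
      nth 0 (oneline lam) i < nth 0 (oneline lam) i.+1.
    move=> le_t lt_t lt_i; have lt_i' := ltnW lt_i.
    rewrite (nth_oneline lam (Ordinal lt_i')) (nth_oneline lam (Ordinal lt_i)) ltnS.
    rewrite -occ_a /=; have := inc_t (a + i - t).
    rewrite -subSn // !subnKC ?addnS; [apply|..]; lia.
  have [i iE] : exists i, t + b = a + i by exists (t + b - a); lia.
  have lt_i : i.+1 < m by lia.
  have lt_i' := ltnW lt_i.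
  rewrite addnS iE -addnS.
  suff: nth 0 (oneline mu) i < nth 0 (oneline mu) i.+1.
    rewrite (nth_oneline mu (Ordinal lt_i')) (nth_oneline mu (Ordinal lt_i)) ltnS.
    by rewrite -occ_mu.
  (* Relative to the window, the increasing run covers a prefix (bounded by [lI lam]), covers the
     whole window (then [lam] occurs in 12...k), lies inside it (then 12...k occurs in [lam]), or
     covers a suffix (bounded by [lT lam]). The middle two contradict the antichain condition. *)
  have [lt_ta|le_at] := ltnP t a; have [lt_end|le_end] := ltnP (t + k) (a + m).
  - apply: lI_increasing; rewrite -hI.
    have le_run : t + k - a <= lI lam.
      by apply: leq_lI => [|l lt_l]; [lia | apply: lam_inc; lia].
    by apply: leq_trans le_run; lia.
  - have lt_0k : a - t < k by lia.
    case/negP: id_avoids_lam; apply/set0Pn; exists (Ordinal lt_0k).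
    apply/occurrencesP; split=> [|x y] /=; first by lia.
    have in_k (z : 'I_m) : a - t + z < k by have := ltn_ord z; lia.
    rewrite !(nth_oneline (1%g : 'S_k) (Ordinal (in_k _))) !perm1 /= -occ_a.
    have tk_occ : t \in occurrences s (1%g : 'S_k) by apply/occurrences_idP.
    have [_ /(_ (Ordinal (in_k x)) (Ordinal (in_k y)))] := occurrencesP _ _ _ tk_occ.
    by rewrite !perm1 /= !addnA !subnKC ?(ltnW lt_ta) // => ->; rewrite ltnS.
  - have lt_0m : t - a < m by lia.
    case/negP: lam_avoids_id; apply/set0Pn; exists (Ordinal lt_0m).
    apply/occurrences_idP; split=> [|x lt_x] /=; first by lia.
    by rewrite addnS; apply: lam_inc; lia.
  - apply: lT_increasing; rewrite -?hT //.
    have le_run : m - (t - a) <= lT lam.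
      by apply: leq_lT => [|l le_l lt_l]; [lia | apply: lam_inc; lia].
    by lia.
(* A window containing just one of the two neighbours has [t + b] as its last position or [t + b.+1]
   as its first, and [rho] fixes these. *)
have unmoved (x : 'I_n) : (x = t + b :> nat \/ x = t + b.+1 :> nat) -> q x = x.
  move=> xE.
  case: (pickP [pred c : 'I_n * 'I_m | (c.1 \in A) && (x == c.1 + c.2 :> nat)]).
    case=> a i /= /andP[Aa /eqP xE'].
    apply: val_inj; rewrite /= (q_in a i) // fix_rho -?xE' //.
    have := no_window a; rewrite /= Aa /= => /negbT; have := ltn_ord i.
    by case: xE; lia.
  move=> out_x; apply: q_out => a i Aa xE'.
  by have := out_x (a, i); rewrite /= Aa xE' eqxx.
have lt0 : t + b < n by lia.
have lt1 : t + b.+1 < n by lia.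
have := inc_t b lt_b.
rewrite !(nth_oneline _ (Ordinal lt0)) !(nth_oneline _ (Ordinal lt1)) !permM.
by rewrite !unmoved //=; [right | left].
Qed.

End Replacement.

(** * Counting permutations by their occurrence sets *)

Lemma card_occurrences_superset_leq (m k n : nat) (lam mu : 'S_m)
    (A : {set 'I_n}) :
  no_self_overlaps lam ->
  ~~ contains mu (1%g : 'S_k) -> ~~ contains (1%g : 'S_k) mu ->
  fixes_endpoints (mu * lam^-1)%g -> lI lam = lI mu -> lT lam = lT mu ->
  #|[set s : 'S_n | ~~ contains s (1%g : 'S_k) & A \subset occurrences s lam]|
  <= #|[set s : 'S_n | ~~ contains s (1%g : 'S_k) & A \subset occurrences s mu]|.
Proof.
move=> nso mu1 mu2 fix_rho hI hT.
set X := [set s | _ & _]; set Y := [set s | _ & _].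
(* A member of [X] shows that the windows at [A] are separated; with [X] empty the bound is
   trivial. *)
have [->|[s0]] := set_0Vmem X; first by rewrite cards0.
rewrite inE => /andP[_ A_s0].
have sepA : separated_windows m A.
  split=> [a /(subsetP A_s0)/occurrencesP[] // | a b Aa Ab].
  exact: no_self_overlaps_separated nso (subsetP A_s0 _ Aa) (subsetP A_s0 _ Ab).
have [q q_windows] := window_permutation sepA fix_rho.
(* Since [q] depends only on [A], left multiplication by [q] is one injection on all of [X]. *)
rewrite -(card_imset X (mulgI q)); apply: subset_leq_card.
apply/subsetP=> _ /imsetP[s + ->]; rewrite !inE => /andP[avoid_s A_s].
have A_qs := occurrences_replaced q_windows A_s; rewrite A_qs andbT.
have invE : ((mu * lam^-1)^-1 = lam * mu^-1)%g by rewrite invMg invgK.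
have := acts_on_windowsV sepA q_windows; rewrite invE => qV_windows.
have := fixes_endpointsV fix_rho; rewrite invE => fix_rhoV.
(* Avoidance is transported backwards: an occurrence of 12...k in [q * s] would survive [q^-1],
   which turns [mu] back into [lam]. Hence the antichain condition is used for [mu]. *)
have := occurrences_id_replaced qV_windows A_qs mu1 mu2 (esym hI) (esym hT) fix_rhoV.
rewrite mulKg => sub_id; apply: contra avoid_s.
by apply: contraNneq => eq0; rewrite -subset0 -eq0.
Qed.

(* Downward induction on [A] in place of signed inclusion-exclusion. *)
Lemma eq_card_fibers (T U : finType) (X : {set T}) (f g : T -> {set U}) :
  (forall A : {set U},
     #|[set x in X | A \subset f x]| = #|[set x in X | A \subset g x]|) ->
  forall A : {set U}, #|[set x in X | f x == A]| = #|[set x in X | g x == A]|.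
Proof.
move=> eq_sup A; have [c] := ubnP #|~: A|; elim: c A => // c IHc A le_c.
have split_sup (h : T -> {set U}) : #|[set x in X | A \subset h x]| =
    #|[set x in X | h x == A]| + \sum_(B : {set U} | A \proper B) #|[set x in X | h x == B]|.
  rewrite -(cardsID [set x | h x == A]); congr (_ + _).
    apply: eq_card => x; rewrite !inE -andbA; congr (_ && _).
    by apply/andP/eqP => [[_ /eqP]|->].
  rewrite -sum1_card (partition_big h (fun B => A \proper B)) /=.
    apply: eq_bigr => B ltAB; rewrite -sum1_card; apply: eq_bigl => x.
    rewrite !inE; case: (h x =P B) => [->|]; last by rewrite !andbF.
    by rewrite (proper_sub ltAB) !andbT; case: eqP ltAB => // ->; rewrite properxx.
  by move=> x; rewrite !inE properEneq eq_sym => /and3P[-> _ ->].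
have := eq_sup A; rewrite !split_sup.
rewrite (eq_bigr (fun B => #|[set x in X | g x == B]|)) => [/addIn //|B ltAB].
apply: IHc; apply: leq_trans (proper_card _) _; last by rewrite -ltnS; exact: le_c.
by rewrite properC.
Qed.

(** * The degenerate case of a pattern equal to 12...k *)

Lemma antichain_Pset m (lam : 'S_m) k :
  to_pattern lam != to_pattern (1%g : 'S_k) -> antichain (Pset lam k) ->
  ~~ contains lam (1%g : 'S_k) /\ ~~ contains (1%g : 'S_k) lam.
Proof.
move=> neq ac; have l0 : to_pattern lam \in Pset lam k by rewrite !inE eqxx.
have l1 : to_pattern (1%g : 'S_k) \in Pset lam k by rewrite !inE eqxx orbT.
by split; [exact: (ac _ _ l0 l1) | apply: (ac _ _ l1 l0); rewrite eq_sym].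
Qed.

Lemma lI_id m : lI (1%g : 'S_m) = m.
Proof.
apply/eqP; rewrite eqn_leq; apply/andP; split.
  by apply/bigmax_leqP => j _; rewrite -ltnS.
apply: leq_lI => // a lt_a; have lt_a' := ltnW lt_a.
by rewrite (nth_oneline _ (Ordinal lt_a')) (nth_oneline _ (Ordinal lt_a)) !perm1 /=.
Qed.

(** An increasing [p] satisfies [p a >= a] by induction upwards from [0], and [p a <= a] by
    induction downwards from [m.-1]. *)
Lemma sorted_perm_id m (p : 'S_m) : lI p = m -> p = 1%g.
Proof.
move=> eq_m.
have mono a b (lt_a : a < m) (lt_b : b < m) : a < b -> p (Ordinal lt_a) < p (Ordinal lt_b).
  move=> lt_ab; rewrite -ltnS -!nth_oneline /=.
  elim: b lt_b lt_ab => // b IHb lt_b; rewrite ltnS leq_eqVlt.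
  case/predU1P=> [->|lt_ab]; first by apply: lI_increasing; rewrite eq_m.
  apply: ltn_trans (IHb (ltnW lt_b) lt_ab) _.
  by apply: lI_increasing; rewrite eq_m.
have ge_id a (lt_a : a < m) : a <= p (Ordinal lt_a).
  elim: a lt_a => // a IHa lt_a; apply: leq_ltn_trans (IHa (ltnW lt_a)) _.
  exact: mono.
have le_id c a (lt_a : a < m) : a + c = m.-1 -> p (Ordinal lt_a) <= a.
  elim: c a lt_a => [|c IHc] a lt_a aE.
    by have := ltn_ord (p (Ordinal lt_a)); lia.
  have lt_a1 : a.+1 < m by lia.
  rewrite -ltnS; apply: leq_trans (IHc a.+1 lt_a1 _); last by lia.
  exact: mono.
apply/permP=> -[a lt_a]; rewrite perm1; apply/val_inj/eqP.
by rewrite eqn_leq /= ge_id (le_id (m.-1 - a)) //; lia.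
Qed.

Lemma lI_eq_id m (lam mu : 'S_m) k : lI lam = lI mu ->
  to_pattern lam = to_pattern (1%g : 'S_k) -> lam = mu.
Proof.
move=> hI eq_lam; have eq_mk : m = k by exact: (congr1 (@tag nat (fun r => 'S_r)) eq_lam).
(* Once the lengths are identified, equality of tagged patterns becomes equality in ['S_m]. *)
move: eq_lam; case: _ / eq_mk => /eqP; rewrite -tag_eqE /tag_eq /= eqxx tagged_asE.
move/eqP=> lam1; rewrite lam1 lI_id in hI.
by rewrite lam1 (sorted_perm_id (esym hI)).
Qed.

Theorem theorem4p23 (k m : nat) (hk : 2 <= k) (hm : 1 <= m)
    (lam mu : 'S_m)
    (hlam : no_self_overlaps lam) (hmu : no_self_overlaps mu)
    (alam : antichain (Pset lam k)) (amu : antichain (Pset mu k))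
    (hfirst : head 0 (oneline lam) = head 0 (oneline mu))
    (hlast : last 0 (oneline lam) = last 0 (oneline mu))
    (hI : lI lam = lI mu) (hT : lT lam = lT mu) :
  forall n : nat,
    #|[set s : 'S_n | avoids s (Pset lam k)]|
    = #|[set s : 'S_n | avoids s (Pset mu k)]|.
Proof.
move=> n; have [->|/eqP neq] := eqVneq lam mu; first by [].
(* If [lam] were 12...k, [antichain] would be vacuous; but then equality of [lI] would force
   [mu = lam], which is excluded here. The same holds for [mu]. *)
have [|lam1 lam2] := antichain_Pset _ alam.
  by apply: contra_not_neq neq; exact: lI_eq_id.
have [|mu1 mu2] := antichain_Pset _ amu.
  by apply: contra_not_neq neq => eq_mu; exact: esym (lI_eq_id (esym hI) eq_mu).
have endpoints (i : 'I_m) : (i == 0 :> nat) || (i.+1 == m) -> lam i = mu i.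
  move=> i_end; apply/val_inj/eqP; rewrite -eqSS -!nth_oneline; apply/eqP.
  case/orP: i_end => /eqP iE; first by rewrite iE !nth0.
  move: hlast; rewrite -!nth_last !size_oneline.
  by have <- : nat_of_ord i = m.-1 by exact: (congr1 predn iE).
have fix_endpoints : fixes_endpoints (mu * lam^-1)%g.
  by move=> i /endpoints eq_i; rewrite permM -eq_i permK.
have fix_endpointsV : fixes_endpoints (lam * mu^-1)%g.
  by move=> i /endpoints eq_i; rewrite permM eq_i permK.
pose X := [set s : 'S_n | ~~ contains s (1%g : 'S_k)].
have avoidE (p : 'S_m) :
    [set s : 'S_n | avoids s (Pset p k)] = [set s in X | occurrences s p == set0].
  apply/setP=> s; rewrite !inE /avoids /= andbT andbC; congr (_ && _).
  by rewrite /contains negbK.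
(* The sets to compare are the fibres of the occurrence map over [set0], so it suffices to compare
   the counts over supersets of each [A]. *)
rewrite !avoidE; apply: eq_card_fibers => A.
have supE (p : 'S_m) : [set s in X | A \subset occurrences s p]
    = [set s | ~~ contains s (1%g : 'S_k) & A \subset occurrences s p].
  by apply/setP=> s; rewrite !inE.
(* All hypotheses are symmetric in [lam] and [mu], so the inequality holds in both directions. *)
rewrite !supE; apply/eqP; rewrite eqn_leq.
by rewrite !card_occurrences_superset_leq.
Qed.
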